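(* Let $R$ be as in the standing setup. If $\dim_kHR\geq2$, then ${}_Rk$ is not in $\mathsf D^c(R)$.
   Context: Standing setup: $k$ is a field and $R$ is a DG algebra over $k$ (cohomological grading) with $R^i=0$ for $i<0$, $R^0=k$, $R^1=0$ and $\dim_kR<\infty$. $HR$ denotes the total cohomology. $\mathsf D(R)$ is the derived category of DG left $R$-modules and $\mathsf D^c(R)$ its full subcategory of compact objects, i.e. those finitely built from ${}_RR$ using distinguished triangles, (de)suspensions, finite direct sums and direct summands. $k=R/R^{\geq1}$ viewed as a DG left $R$-module. *)

(* Defs.v *)
From HB Require Import structures.
From mathcomp Require Import all_boot all_order all_algebra all_field.
Set Implicit Arguments. Unset Strict Implicit. Unset Printing Implicit Defensive.
Import Order.TTheory GRing.Theory Num.Theory.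
Local Open Scope ring_scope.

Record graded (K : fieldType) (V : lmodType K) := Graded {
  gdeg : int -> V -> bool;
  gdeg0 : forall n, gdeg n 0;
  gdeg_lin : forall n (a : K) x y, gdeg n x -> gdeg n y -> gdeg n (a *: x + y);
  gdeg_span : forall v : V, exists (s : seq int) (f : int -> V),
      [/\ uniq s, (forall n, gdeg n (f n)) & v = \sum_(n <- s) f n];
  gdeg_indep : forall (s : seq int) (f : int -> V), uniq s ->
      (forall n, gdeg n (f n)) -> \sum_(n <- s) f n = 0 ->
      forall n, n \in s -> f n = 0 }.

(** DG algebras R over K (cohomological grading) with R^i = 0 for i < 0,
    R^0 = K, R^1 = 0, dim_K R < oo (finite dimensionality is built in
    via falgType).  [dga_aug] is the augmentation R -> R/R^{>=1} = K; it
    is uniquely determined by the other data. *)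
Record dga (K : fieldType) := DGA {
  dga_car :> falgType K;
  dga_gr : graded dga_car;
  dga_d : dga_car -> dga_car;
  dga_d_lin : forall (a : K) x y, dga_d (a *: x + y) = a *: dga_d x + dga_d y;
  dga_d_deg : forall n x, gdeg dga_gr n x -> gdeg dga_gr (n + 1) (dga_d x);
  dga_dd : forall x, dga_d (dga_d x) = 0;
  dga_mul_deg : forall i j x y, gdeg dga_gr i x -> gdeg dga_gr j y ->
      gdeg dga_gr (i + j) (x * y);
  dga_leibniz : forall i x y, gdeg dga_gr i x ->
      dga_d (x * y) = dga_d x * y + ((-1 : K) ^+ `|i|%N) *: (x * dga_d y);
  dga_neg : forall i x, i < 0 -> gdeg dga_gr i x -> x = 0;
  dga_deg0 : forall x, gdeg dga_gr 0 x <-> exists c : K, x = c%:A;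
  dga_deg1 : forall x, gdeg dga_gr 1 x -> x = 0;
  dga_aug : dga_car -> K;
  dga_aug_lin : forall (a : K) x y, dga_aug (a *: x + y) = a * dga_aug x + dga_aug y;
  dga_aug1 : dga_aug 1 = 1;
  dga_augM : forall x y, dga_aug (x * y) = dga_aug x * dga_aug y;
  dga_aug_deg : forall i x, i != 0 -> gdeg dga_gr i x -> dga_aug x = 0 }.

Arguments dga_d {K} d _ : rename.
Arguments dga_aug {K} d _ : rename.
Arguments dga_gr {K} d : rename.

Definition dimHR (K : fieldType) (R : dga K) : nat :=
  (\dim (lker (linfun (dga_d R : dga_car R -> dga_car R))) - \dim (limg (linfun (dga_d R : dga_car R -> dga_car R))))%N.

Record dgmod (K : fieldType) (R : dga K) := DGMod {
  dgm_car :> lmodType K;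
  dgm_gr : graded dgm_car;
  dgm_d : dgm_car -> dgm_car;
  dgm_d_lin : forall (a : K) x y, dgm_d (a *: x + y) = a *: dgm_d x + dgm_d y;
  dgm_d_deg : forall n x, gdeg dgm_gr n x -> gdeg dgm_gr (n + 1) (dgm_d x);
  dgm_dd : forall x, dgm_d (dgm_d x) = 0;
  dgm_act : R -> dgm_car -> dgm_car;
  dgm_act_linl : forall (a : K) r s m,
      dgm_act (a *: r + s) m = a *: dgm_act r m + dgm_act s m;
  dgm_act_linr : forall r (a : K) m n,
      dgm_act r (a *: m + n) = a *: dgm_act r m + dgm_act r n;
  dgm_act_assoc : forall r s m, dgm_act (r * s) m = dgm_act r (dgm_act s m);
  dgm_act1 : forall m, dgm_act 1 m = m;
  dgm_act_deg : forall i j r m, gdeg (dga_gr R) i r -> gdeg dgm_gr j m ->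
      gdeg dgm_gr (i + j) (dgm_act r m);
  dgm_leibniz : forall i r m, gdeg (dga_gr R) i r ->
      dgm_d (dgm_act r m) =
        dgm_act (dga_d R r) m + ((-1 : K) ^+ `|i|%N) *: dgm_act r (dgm_d m) }.

Arguments dgm_d {K R} d _ : rename.
Arguments dgm_act {K R} d _ _ : rename.
Arguments dgm_gr {K R} d : rename.

Definition is_dgmap (K : fieldType) (R : dga K) (X Y : dgmod R)
    (f : X -> Y) : Prop :=
  [/\ forall (a : K) x y, f (a *: x + y) = a *: f x + f y,
      forall n x, gdeg (dgm_gr X) n x -> gdeg (dgm_gr Y) n (f x),
      forall x, f (dgm_d X x) = dgm_d Y (f x) &
      forall r x, f (dgm_act X r x) = dgm_act Y r (f x)].

(** Quasi-isomorphisms: H(f) is bijective (equivalently degreewise). *)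
Definition quasi_iso (K : fieldType) (R : dga K) (X Y : dgmod R)
    (f : X -> Y) : Prop :=
  [/\ is_dgmap f,
      forall y, dgm_d Y y = 0 ->
        exists x z, dgm_d X x = 0 /\ f x = y + dgm_d Y z &
      forall x, dgm_d X x = 0 -> (exists z, f x = dgm_d Y z) ->
        exists w, x = dgm_d X w].

Definition ses (K : fieldType) (R : dga K) (X Y Z : dgmod R)
    (f : X -> Y) (g : Y -> Z) : Prop :=
  [/\ is_dgmap f, is_dgmap g, injective f,
      forall z, exists y, g y = z &
      forall y, g y = 0 <-> exists x, y = f x].

Section Regular.
Variables (K : fieldType) (R : dga K).

Lemma reg_d_lin (a : K) (x y : R) :
  dga_d R (a *: x + y) = a *: dga_d R x + dga_d R y.
Proof. exact: dga_d_lin. Qed.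

Lemma reg_act_linl (a : K) (r s m : R) : (a *: r + s) * m = a *: (r * m) + s * m.
Proof. by rewrite mulrDl -scalerAl. Qed.

Lemma reg_act_linr (r : R) (a : K) (m n : R) : r * (a *: m + n) = a *: (r * m) + r * n.
Proof. by rewrite mulrDr scalerAr. Qed.

Definition regmod : dgmod R :=
  @DGMod K R R (dga_gr R) (dga_d R) reg_d_lin (@dga_d_deg K R) (@dga_dd K R)
    (fun r m => r * m) reg_act_linl reg_act_linr (fun r s m => esym (mulrA r s m))
    (@mul1r R) (@dga_mul_deg K R) (@dga_leibniz K R).

Definition kdeg (n : int) (c : K^o) : bool := (n == 0) || (c == 0).

Lemma kdeg0 n : kdeg n 0. Proof. by rewrite /kdeg eqxx orbT. Qed.

Lemma kdeg_lin n (a : K) (x y : K^o) : kdeg n x -> kdeg n y -> kdeg n (a *: x + y).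
Proof.
rewrite /kdeg; case: (n == 0) => //= /eqP -> /eqP ->.
by rewrite scaler0 addr0.
Qed.

Lemma kdeg_span (v : K^o) : exists (s : seq int) (f : int -> K^o),
  [/\ uniq s, (forall n, kdeg n (f n)) & v = \sum_(n <- s) f n].
Proof.
exists [:: 0], (fun n => if n == 0 then v else 0); split => //.
  by move=> n; rewrite /kdeg; case: (n == 0) => //; rewrite eqxx orbT.
by rewrite big_seq1 eqxx.
Qed.

Lemma kdeg_indep (s : seq int) (f : int -> K^o) : uniq s ->
  (forall n, kdeg n (f n)) -> \sum_(n <- s) f n = 0 ->
  forall n, n \in s -> f n = 0.
Proof.
move=> us hf hs n ns.
have h0 : forall m, m != 0 -> f m = 0.
  by move=> m m0; move: (hf m); rewrite /kdeg (negbTE m0) => /eqP.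
case: (eqVneq n 0) => [n0|/h0] //; subst n.
rewrite (bigD1_seq 0) //= big1 ?addr0 // in hs.

Qed.

Definition kgr : graded (K^o) := Graded kdeg0 kdeg_lin kdeg_span kdeg_indep.

Definition kd (c : K^o) : K^o := 0.

Lemma kd_lin (a : K) (x y : K^o) : kd (a *: x + y) = a *: kd x + kd y.
Proof. by rewrite /kd scaler0 addr0. Qed.

Lemma kd_deg n (x : K^o) : kdeg n x -> kdeg (n + 1) (kd x).
Proof. by move=> _; apply: kdeg0. Qed.

Lemma kdd (x : K^o) : kd (kd x) = 0. Proof. by []. Qed.

Definition kact (r : R) (c : K^o) : K^o := dga_aug R r * c.

Lemma kact_linl (a : K) (r s : R) (m : K^o) :
  kact (a *: r + s) m = a *: kact r m + kact s m.
Proof. by rewrite /kact dga_aug_lin mulrDl /GRing.scale /= mulrA. Qed.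

Lemma kact_linr (r : R) (a : K) (m n : K^o) :
  kact r (a *: m + n) = a *: kact r m + kact r n.
Proof.
rewrite /kact mulrDr; congr (_ + _).
by rewrite /GRing.scale /= mulrCA.
Qed.

Lemma kact_assoc (r s : R) (m : K^o) : kact (r * s) m = kact r (kact s m).
Proof. by rewrite /kact dga_augM mulrA. Qed.

Lemma kact1 (m : K^o) : kact 1 m = m.
Proof. by rewrite /kact dga_aug1 mul1r. Qed.

Lemma kact_deg i j (r : R) (m : K^o) : gdeg (dga_gr R) i r -> kdeg j m ->
  kdeg (i + j) (kact r m).
Proof.
move=> hr hm; case: (eqVneq i 0) => [->|i0].
  rewrite add0r; move: hm; rewrite /kdeg /kact.
  by case: (j == 0) => //= /eqP ->; rewrite mulr0 eqxx.
by rewrite /kact (dga_aug_deg i0 hr) mul0r kdeg0.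
Qed.

Lemma dga_d0 : dga_d R 0 = 0.
Proof.
have h := @dga_d_lin K R 1 0 0; rewrite !scale1r addr0 in h.
by apply: (addrI (dga_d R 0)); rewrite addr0 -h.
Qed.

Lemma kleibniz i (r : R) (m : K^o) : gdeg (dga_gr R) i r ->
  kd (kact r m) = kact (dga_d R r) m + ((-1 : K) ^+ `|i|%N) *: kact r (kd m).
Proof.
move=> hr; rewrite /kd /kact mulr0 scaler0 addr0.
have hd := dga_d_deg hr.
case: (eqVneq (i + 1) 0) => [i1|i1]; last by rewrite (dga_aug_deg i1 hd) mul0r.
have ineg : i < 0.
  by move: i1 => /eqP; rewrite addr_eq0 => /eqP ->; rewrite ltrN10.
rewrite (dga_neg ineg hr) dga_d0.
have h := @dga_aug_lin K R 1 0 0; rewrite scale1r addr0 mul1r in h.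
suff -> : dga_aug R 0 = 0 by rewrite mul0r.
by apply: (addrI (dga_aug R 0)); rewrite addr0 -h.
Qed.

Definition kmod : dgmod R :=
  @DGMod K R (K^o) kgr kd kd_lin kd_deg kdd kact kact_linl kact_linr
    kact_assoc kact1 kact_deg kleibniz.

End Regular.

(** D^c(R): the objects finitely built from {}_R R, i.e. the smallest
    class of DG R-modules containing {}_R R and closed under isomorphism in
    D(R) (zig-zags of quasi-isomorphisms), under (de)suspensions, cones,
    finite direct sums (all expressed via two-out-of-three for short exact
    sequences of DG modules, which give all distinguished triangles up to
    isomorphism) and under direct summands (retracts). *)
Inductive compact (K : fieldType) (R : dga K) : dgmod R -> Prop :=
| compact_free : compact (regmod R)
| compact_qis : forall (X Y : dgmod R) (f : X -> Y),
    quasi_iso f -> compact X -> compact Y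
| compact_qis_inv : forall (X Y : dgmod R) (f : X -> Y),
    quasi_iso f -> compact Y -> compact X
| compact_ses3 : forall (X Y Z : dgmod R) (f : X -> Y) (g : Y -> Z),
    ses f g -> compact X -> compact Y -> compact Z
| compact_ses2 : forall (X Y Z : dgmod R) (f : X -> Y) (g : Y -> Z),
    ses f g -> compact X -> compact Z -> compact Y
| compact_ses1 : forall (X Y Z : dgmod R) (f : X -> Y) (g : Y -> Z),
    ses f g -> compact Y -> compact Z -> compact X
| compact_retract : forall (X Z : dgmod R) (i : X -> Z) (p : Z -> X),
    is_dgmap i -> is_dgmap p -> (forall x, p (i x) = x) ->
    compact Z -> compact X.

(* Main.v *)
(* Suppose k is compact.  The groups Tor^t(k, k) vanish for t large, since the
   analogous property holds for R and passes to everything finitely built from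
   it.  A minimal semifree resolution P of the right module k is built by
   attaching cells that kill the lowest positive cohomology; as R^1 = 0, the
   cells have nondecreasing degrees and the differential of P (x)_R k is zero,
   so the degrees of the cells are bounded and some finite stage P is acyclic in
   all the degrees needed.  Let e be its last cell, of degree w, and z a top
   nonzero class of HR, in degree d > 0.  The boundary of e z lives on cells of
   degree at most w, hence in degrees beyond the cohomology of these cells, and
   can be corrected: e z - c is a cocycle of degree w + d > 0, thus a boundary.
   Projecting onto the last cell makes z a boundary. *)
Require Import Defs.
From mathcomp Require Import all_boot all_order all_algebra all_field.
From HB Require Import structures.
From mathcomp Require Import boolp functions zify.
Set Implicit Arguments. Unset Strict Implicit. Unset Printing Implicit Defensive.
Import Order.TTheory GRing.Theory Num.Theory.
Local Open Scope ring_scope.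

(** * Homogeneous components *)

Section Components.
Variables (K : fieldType).

(** The finite support is asserted but not recorded, so that two decompositions can be compared
    pointwise. *)
Definition components (V : lmodType K) (G : graded V) (v : V) (c : int -> V) :=
  (forall n, gdeg G n (c n)) /\
  exists s : seq int, [/\ uniq s, forall n, n \notin s -> c n = 0 &
    v = \sum_(n <- s) c n].

Lemma big_supp_subset (V : lmodType K) (s s' : seq int) (c : int -> V) :
  uniq s -> uniq s' -> {subset s <= s'} -> (forall n, n \notin s -> c n = 0) ->
  \sum_(n <- s) c n = \sum_(n <- s') c n.
Proof.
move=> us us' ss c0; rewrite [RHS](bigID (mem s)) /= [X in _ + X]big1; last first.
  by move=> i /c0.
rewrite addr0 -[RHS]big_filter; apply: perm_big; apply: uniq_perm => //.
  exact: filter_uniq.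
move=> n; rewrite mem_filter /=; case: (boolP (n \in s)) => //= ns.
by rewrite ss.
Qed.

Lemma gdegZ (V : lmodType K) (G : graded V) n (a : K) v :
  gdeg G n v -> gdeg G n (a *: v).
Proof.
by move=> h; have := gdeg_lin a h (gdeg0 G n); rewrite addr0.
Qed.

Lemma gdegD (V : lmodType K) (G : graded V) n u v :
  gdeg G n u -> gdeg G n v -> gdeg G n (u + v).
Proof. by move=> h1 h2; have := gdeg_lin 1 h1 h2; rewrite scale1r. Qed.

Lemma gdegN (V : lmodType K) (G : graded V) n v : gdeg G n v -> gdeg G n (- v).
Proof. by move=> h; rewrite -scaleN1r; apply: gdegZ. Qed.

Lemma gdegB (V : lmodType K) (G : graded V) n u v :
  gdeg G n u -> gdeg G n v -> gdeg G n (u - v).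
Proof. by move=> h1 h2; apply: gdegD => //; apply: gdegN. Qed.

Lemma gdeg_sum (V : lmodType K) (G : graded V) n (I : Type) (s : seq I)
    (P : pred I) (F : I -> V) :
  (forall i, P i -> gdeg G n (F i)) -> gdeg G n (\sum_(i <- s | P i) F i).
Proof.
by move=> h; apply: (big_ind (fun x => gdeg G n x)) => //; [apply: gdeg0 | move=> x y; apply: gdegD].
Qed.

Lemma components_ex (V : lmodType K) (G : graded V) v :
  exists c, components G v c.
Proof.
have [s [f [us hf ->]]] := gdeg_span G v.
exists (fun n => if n \in s then f n else 0); split.
  by move=> n; case: ifP => _ //; apply: gdeg0.
exists s; split => // [n /negbTE -> //|].
by rewrite big_seq [RHS]big_seq; apply: eq_bigr => i ->.
Qed.

Lemma components_lin (V : lmodType K) (G : graded V) (a : K) u v c c' :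
  components G u c -> components G v c' ->
  components G (a *: u + v) (fun n => a *: c n + c' n).
Proof.
move=> [hc [s [us c0 ->]]] [hc' [s' [us' c0' ->]]]; split.
  by move=> n; apply: gdeg_lin.
exists (undup (s ++ s')); split; first exact: undup_uniq.
  move=> n; rewrite mem_undup mem_cat negb_or => /andP[/c0 -> /c0' ->].
  by rewrite scaler0 addr0.
rewrite big_split /= -scaler_sumr; congr (_ *: _ + _); apply: big_supp_subset => //;
  try exact: undup_uniq; by move=> n h; rewrite mem_undup mem_cat h ?orbT.
Qed.

Lemma components_uniq (V : lmodType K) (G : graded V) v c c' :
  components G v c -> components G v c' -> forall n, c n = c' n.
Proof.
move=> h h' n.
have [hd [s [us d0 e0]]] := components_lin (-1) h h'.
rewrite scaleN1r addNr in e0.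
have e : -1 *: c n + c' n = 0.
  case: (boolP (n \in s)) => [ns|/d0 //].
  exact: (gdeg_indep us hd (esym e0) ns).
by apply/eqP; rewrite eq_sym -subr_eq0 addrC -scaleN1r e.
Qed.

Lemma components_homog (V : lmodType K) (G : graded V) n v :
  gdeg G n v -> components G v (fun i => if i == n then v else 0).
Proof.
move=> hv; split; first by move=> i; case: eqP => [->|_] //; apply: gdeg0.
exists [:: n]; split => // [i|]; first by rewrite inE => /negbTE ->.
by rewrite big_seq1 eqxx.
Qed.

Lemma components_map (V W : lmodType K) (G : graded V) (H : graded W)
    (h : V -> W) k v c :
  (forall (a : K) x y, h (a *: x + y) = a *: h x + h y) ->
  (forall n x, gdeg G n x -> gdeg H (n + k) (h x)) ->
  components G v c -> components H (h v) (fun n => h (c (n - k))).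
Proof.
move=> hl hk [hc [s [us c0 ->]]].
have h0 : h 0 = 0.
  by have := hl (-1) 0 0; rewrite addr0 !scaleN1r oppr0 addNr.
have hD x y : h (x + y) = h x + h y by have := hl 1 x y; rewrite !scale1r.
split; first by move=> n; have := hk _ _ (hc (n - k)); rewrite subrK.
exists (map (fun i => i + k) s); split.
- by rewrite map_inj_uniq // => i j /addIr.
- move=> n nn; rewrite c0 // ; apply: contra nn => nn.
  by apply/mapP; exists (n - k); rewrite ?subrK.
rewrite (big_morph h hD h0) big_map; apply: eq_bigr => i _.
by rewrite addrK.
Qed.

(* A graded linear equation [h1 x + h2 y = b] with homogeneous right-hand side
   has a homogeneous solution as soon as it has a solution. *)
Lemma homog_solution (V1 V2 W : lmodType K) (G1 : graded V1) (G2 : graded V2)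
    (H : graded W) (h1 : V1 -> W) (h2 : V2 -> W) k1 k2 n x y b :
  (forall (a : K) x y, h1 (a *: x + y) = a *: h1 x + h1 y) ->
  (forall n x, gdeg G1 n x -> gdeg H (n + k1) (h1 x)) ->
  (forall (a : K) x y, h2 (a *: x + y) = a *: h2 x + h2 y) ->
  (forall n x, gdeg G2 n x -> gdeg H (n + k2) (h2 x)) ->
  gdeg H n b -> h1 x + h2 y = b ->
  exists c1 c2, [/\ components G1 x c1, components G2 y c2 &
    h1 (c1 (n - k1)) + h2 (c2 (n - k2)) = b].
Proof.
move=> l1 d1 l2 d2 hb e.
have [c1 C1] := components_ex G1 x; have [c2 C2] := components_ex G2 y.
exists c1, c2; split => //.
have := components_lin 1 (components_map l1 d1 C1) (components_map l2 d2 C2).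
rewrite scale1r e => C; have := components_uniq C (components_homog hb) n.
by rewrite eqxx scale1r.
Qed.

Lemma homog_preimage (V W : lmodType K) (G : graded V) (H : graded W)
    (h : V -> W) k n x b :
  (forall (a : K) x y, h (a *: x + y) = a *: h x + h y) ->
  (forall n x, gdeg G n x -> gdeg H (n + k) (h x)) ->
  gdeg H n b -> h x = b -> exists2 x', gdeg G (n - k) x' & h x' = b.
Proof.
move=> hl hd hb e.
have h0 : h 0 = 0 by have := hl (-1) 0 0; rewrite addr0 !scaleN1r oppr0 addNr.
(* [homog_solution] is used with both maps equal to [h] and second unknown 0, whose components all
   vanish. *)
have e' : h x + h 0 = b by rewrite h0 addr0.
have [c1 [c2 [[C1 _] C2 <-]]] := homog_solution hl hd hl hd hb e'.
exists (c1 (n - k)) => //.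
rewrite (components_uniq C2 (components_homog (gdeg0 _ n))).
by rewrite if_same h0 addr0.
Qed.

End Components.

(** * Cell complexes *)

Section Linear.
Variables (K : fieldType) (R : dga K).

HB.instance Definition _ := GRing.isLinear.Build K R R _ (dga_d R) (@dga_d_lin K R).

HB.instance Definition _ (X : dgmod R) :=
  GRing.isLinear.Build K X X _ (dgm_d X) (@dgm_d_lin K R X).

HB.instance Definition _ (X : dgmod R) (r : R) :=
  GRing.isLinear.Build K X X _ (dgm_act X r) (@dgm_act_linr K R X r).

(** The arguments are swapped so that linearity in the ring variable can be declared as a linear
    structure. *)
Definition act_on (X : dgmod R) (m : X) (r : R) := dgm_act X r m.

HB.instance Definition _ (X : dgmod R) (m : X) :=
  GRing.isLinear.Build K R X _ (act_on m)
    (fun a r s => @dgm_act_linl K R X a r s m).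

Lemma dgm_act0l (X : dgmod R) (m : X) : dgm_act X 0 m = 0.
Proof. exact: (linear0 (act_on m)). Qed.

Lemma dgm_act_suml (X : dgmod R) (m : X) I (s : seq I) P (F : I -> R) :
  dgm_act X (\sum_(i <- s | P i) F i) m = \sum_(i <- s | P i) dgm_act X (F i) m.
Proof. exact: (linear_sum (act_on m)). Qed.

Lemma dgm_actDl (X : dgmod R) (m : X) r s :
  dgm_act X (r + s) m = dgm_act X r m + dgm_act X s m.
Proof. exact: (linearD (act_on m)). Qed.

Lemma dgm_actZl (X : dgmod R) (m : X) a r :
  dgm_act X (a *: r) m = a *: dgm_act X r m.
Proof. exact: (linearZ_LR (act_on m)). Qed.

Lemma dgm_dZ (X : dgmod R) a (x : X) : dgm_d X (a *: x) = a *: dgm_d X x.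
Proof. exact: linearZ_LR. Qed.

Section Map.
Variables (X Y : dgmod R) (f : X -> Y).
Hypothesis hf : is_dgmap f.

Lemma dgmapD x y : f (x + y) = f x + f y.
Proof. by case: hf => h _ _ _; have := h 1 x y; rewrite !scale1r. Qed.
Lemma dgmap0 : f 0 = 0.
Proof. by apply: (addrI (f 0)); rewrite -dgmapD !addr0. Qed.
Lemma dgmapZ a x : f (a *: x) = a *: f x.
Proof. by case: hf => h _ _ _; have := h a x 0; rewrite dgmap0 !addr0. Qed.
Lemma dgmapB x y : f (x - y) = f x - f y.
Proof. by rewrite dgmapD -scaleN1r dgmapZ scaleN1r. Qed.
Lemma dgmap_sum I (s : seq I) P (F : I -> X) :
  f (\sum_(i <- s | P i) F i) = \sum_(i <- s | P i) f (F i).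
Proof. exact: (big_morph f dgmapD dgmap0). Qed.
Lemma dgmap_deg n x : gdeg (dgm_gr X) n x -> gdeg (dgm_gr Y) n (f x).
Proof. by case: hf => _ h _ _; apply: h. Qed.
Lemma dgmap_d x : f (dgm_d X x) = dgm_d Y (f x).
Proof. by case: hf. Qed.
Lemma dgmap_act r x : f (dgm_act X r x) = dgm_act Y r (f x).
Proof. by case: hf. Qed.
End Map.

(* [P] encodes the right DG module with R-basis e_0, ..., e_(csz P - 1),
   e_l of degree [cdeg P l], and d e_l = \sum_i e_i * ccol P l i. *)
Record cells := Cells {
  csz : nat;
  cdeg : nat -> nat;
  ccol : nat -> nat -> R }.

(* The differential of P (x)_R X; the chain \sum_i e_i (x) x_i is encoded as
   the sequence x, which vanishes from [csz P] on. *)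
Definition cdiff (P : cells) (X : dgmod R) (x : nat -> X) : nat -> X :=
  fun i => (-1 : K) ^+ cdeg P i *: dgm_d X (x i) +
           \sum_(l < csz P) dgm_act X (ccol P l i) (x l).

(** For triangular [P] and m <= [csz P] these chains form the subcomplex on the first m cells; the
    inductions below run along this filtration. *)
Definition supp (X : dgmod R) (m : nat) (x : nat -> X) :=
  forall i, (m <= i)%N -> x i = 0.

Definition homog (P : cells) (X : dgmod R) (t : int) (x : nat -> X) :=
  forall i, gdeg (dgm_gr X) (t - (cdeg P i)%:Z) (x i).

(** The chain e_q (x) u. *)
Definition elem (X : dgmod R) (q : nat) (u : X) : nat -> X :=
  fun i => if i == q then u else 0.

(** Kept apart from [cells_ok] because the proof that an attached complex is [cells_ok] already
    relies on it. *)
Definition cells_tri (P : cells) :=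
  forall l i, (l < csz P)%N -> (l <= i)%N -> ccol P l i = 0.

(** [ok_cycle] says d(d e_l) = 0. The first three conditions force all nonzero coefficients of the
    differential into positive degree, which is minimality. *)
Record cells_ok (P : cells) : Prop := CellsOk {
  ok_mono : forall i l, (i <= l)%N -> (l < csz P)%N -> (cdeg P i <= cdeg P l)%N;
  ok_tri : cells_tri P;
  ok_deg : forall l, (l < csz P)%N -> homog P (X := regmod R) (cdeg P l).+1%:Z (ccol P l);
  ok_cycle : forall l, (l < csz P)%N -> cdiff P (X := regmod R) (ccol P l) = 0 }.

Definition extends (P P' : cells) :=
  (csz P <= csz P')%N /\
  forall l, (l < csz P)%N -> cdeg P' l = cdeg P l /\ ccol P' l = ccol P l.

Lemma extends_refl P : extends P P.
Proof. by split. Qed.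

Lemma extends_trans P Q S : extends P Q -> extends Q S -> extends P S.
Proof.
move=> [a b] [c d]; split; first exact: leq_trans c.
move=> l hl; have [<- <-] := b l hl.
by apply: d; apply: leq_trans a.
Qed.

Section Chains.
Variables (P : cells) (X : dgmod R).
Implicit Types (x y : nat -> X) (t : int).

Lemma suppD m x y : supp m x -> supp m y -> supp m (x + y).
Proof. by move=> h1 h2 i hi; rewrite !fctE h1 // h2 // addr0. Qed.
Lemma suppN m x : supp m x -> supp m (- x).
Proof. by move=> h i hi; rewrite !fctE h // oppr0. Qed.
Lemma suppB m x y : supp m x -> supp m y -> supp m (x - y).
Proof. by move=> h1 h2; apply: suppD => //; apply: suppN. Qed.
Lemma supp0 m : supp m (0 : nat -> X).
Proof. by []. Qed.
Lemma supp_le m n x : (m <= n)%N -> supp m x -> supp n x.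
Proof. by move=> h hx i hi; apply: hx; apply: leq_trans hi. Qed.
Lemma supp_elem m q u : (q < m)%N -> supp m (elem q u : nat -> X).
Proof.
by move=> qm i hi; rewrite /elem; case: eqP => // e; move: hi; rewrite e leqNgt qm.
Qed.
Lemma suppS m x : supp m.+1 x -> x m = 0 -> supp m x.
Proof.
by move=> h hm i; rewrite leq_eqVlt => /orP[/eqP <- //|/h].
Qed.

Lemma homogD t x y : homog P t x -> homog P t y -> homog P t (x + y).
Proof. by move=> h1 h2 i; apply: gdegD; [apply: h1 | apply: h2]. Qed.
Lemma homogN t x : homog P t x -> homog P t (- x).
Proof. by move=> h i; apply: gdegN; apply: h. Qed.
Lemma homogB t x y : homog P t x -> homog P t y -> homog P t (x - y).
Proof. by move=> h1 h2; apply: homogD => //; apply: homogN. Qed.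
Lemma homog0 t : homog P t (0 : nat -> X).
Proof. by move=> i; apply: gdeg0. Qed.
Lemma homog_elem t q u :
  gdeg (dgm_gr X) (t - (cdeg P q)%:Z) u -> homog P t (elem q u : nat -> X).
Proof. by move=> h i; rewrite /elem; case: eqP => [->|_] //; apply: gdeg0. Qed.

Lemma cdiffD x y : cdiff P (x + y) = cdiff P x + cdiff P y.
Proof.
apply/funext => i; rewrite /cdiff !fctE linearD scalerDr addrACA -big_split /=.
by congr (_ + _); apply: eq_bigr => l _; rewrite linearD.
Qed.
Lemma cdiff0 : cdiff P (0 : nat -> X) = 0.
Proof. by apply: (addrI (cdiff P 0)); rewrite -cdiffD !addr0. Qed.
Lemma cdiffN x : cdiff P (- x) = - cdiff P x.
Proof. by apply: (addrI (cdiff P x)); rewrite -cdiffD !subrr cdiff0. Qed.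
Lemma cdiffB x y : cdiff P (x - y) = cdiff P x - cdiff P y.
Proof. by rewrite cdiffD cdiffN. Qed.
Lemma cdiffZ a x : cdiff P (a *: x) = a *: cdiff P x.
Proof.
apply/funext => i; rewrite /cdiff !fctE linearZ scalerDr /= !scalerA mulrC.
congr (_ + _); rewrite scaler_sumr; apply: eq_bigr => l _.
by rewrite linearZ.
Qed.

Lemma supp_cdiff m x : cells_tri P -> (m <= csz P)%N -> supp m x ->
  supp m (cdiff P x).
Proof.
move=> tri hm hx i hi; rewrite /cdiff hx // linear0 scaler0 add0r big1 // => l _.
have [lm|lm] := ltnP l m; last by rewrite hx // linear0.
by rewrite tri ?dgm_act0l // (leq_trans (ltnW lm)).
Qed.

Hypothesis okP : cells_ok P.
Let triP := ok_tri okP.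

(** Modulo the earlier cells only the internal differential survives, by triangularity. *)
Lemma cdiff_top q x : (q < csz P)%N -> supp q.+1 x ->
  cdiff P x q = (-1 : K) ^+ cdeg P q *: dgm_d X (x q).
Proof.
move=> hm hx; rewrite /cdiff big1 ?addr0 // => l _.
have [lq|lq] := leqP l q; last by rewrite hx // linear0.
by rewrite triP ?dgm_act0l.
Qed.

Lemma homog_cdiff t x : homog P t x -> homog P (t + 1) (cdiff P x).
Proof.
move=> hx i; apply: gdegD.
  by apply: gdegZ; rewrite addrAC; apply: dgm_d_deg; apply: hx.
apply: gdeg_sum => l _.
have -> : t + 1 - (cdeg P i)%:Z = ((cdeg P l).+1%:Z - (cdeg P i)%:Z) + (t - (cdeg P l)%:Z).
  lia.
apply: dgm_act_deg; last exact: hx.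
exact: (ok_deg okP).
Qed.

Lemma cdiffK x : cdiff P (cdiff P x) = 0.
Proof.
apply/funext => h; rewrite {1}/cdiff {1}/cdiff [RHS]/(0 h).
rewrite linearD linearZ /= dgm_dd scaler0 add0r linear_sum scaler_sumr /=.
(* All terms are regrouped by the coordinate [x l], so that each l can be treated alone. *)
rewrite [X in _ + X](_ : _ = \sum_(l < csz P) ((-1) ^+ cdeg P l *:
    dgm_act X (ccol P l h) (dgm_d X (x l)) +
    \sum_(i < csz P) dgm_act X (ccol P i h * ccol P l i) (x l))); last first.
  rewrite big_split /= exchange_big /= -big_split /=; apply: eq_bigr => i _.
  rewrite linearD linearZ linear_sum /=; congr (_ + _).
  by apply: eq_bigr => l _; rewrite dgm_act_assoc.
rewrite -big_split /= big1 // => l _.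
have [lh|hl] := leqP l h.
  rewrite (ok_tri okP (ltn_ord l) lh) !dgm_act0l linear0 !scaler0 !add0r.
  rewrite big1 // => i _; have [li|il] := leqP l i.
    by rewrite (ok_tri okP (ltn_ord l) li) mulr0 dgm_act0l.
  by rewrite (ok_tri okP (ltn_ord i) (leq_trans (ltnW il) lh)) mul0r dgm_act0l.
have e := congr1 (fun g => dgm_act X (g h) (x l)) (ok_cycle okP (ltn_ord l)).
rewrite /cdiff /= dgm_act0l dgm_actDl dgm_actZl dgm_act_suml in e.
(* By monotonicity this degree is a natural number, so the Leibniz sign times (-1)^(cdeg P h) is
   (-1)^(cdeg P l + 1). The two terms in d(x l) cancel, and [ok_cycle] kills the rest. *)
have dl : gdeg (dga_gr R) ((cdeg P l).+1 - cdeg P h)%N%:Z (ccol P l h).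
  have := ok_deg okP (ltn_ord l) h; rewrite subzn //.
  by apply: leqW; apply: (ok_mono okP (ltnW hl)).
rewrite (dgm_leibniz _ dl) absz_nat scalerDr scalerA -exprD subnKC; last first.
  by apply: leqW; apply: (ok_mono okP (ltnW hl)).
rewrite exprS mulN1r scaleNr -addrA [X in _ + X]addrA addNr add0r; exact: e.
Qed.


(** Induction along the cell filtration: the top coordinate of a cocycle is a cocycle of X, and
    subtracting the boundary of an elementary chain removes it. *)
Lemma cdiff_exact m t x : (m <= csz P)%N ->
  (forall i u, (i < m)%N -> gdeg (dgm_gr X) (t - (cdeg P i)%:Z) u ->
    dgm_d X u = 0 ->
    exists2 v, gdeg (dgm_gr X) (t - 1 - (cdeg P i)%:Z) v & u = dgm_d X v) ->
  supp m x -> homog P t x -> cdiff P x = 0 ->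
  exists y, [/\ supp m y, homog P (t - 1) y & cdiff P y = x].
Proof.
elim: m x => [|m IH] x hm hX hs hh hd.
  exists 0; split; [exact: supp0|exact: homog0|].
  by rewrite cdiff0; apply/funext => i; rewrite hs.
have top0 : dgm_d X (x m) = 0.
  have := congr1 (fun g => g m) hd; rewrite cdiff_top //= => /eqP.
  by rewrite scaler_eq0 signr_eq0 /= => /eqP.
have [v hv ev] := hX m (x m) (ltnSn m) (hh m) top0.
pose v' := (-1 : K) ^+ cdeg P m *: v.
have hsv : supp m.+1 (elem m v') by apply: supp_elem.
have hhv : homog P (t - 1) (elem m v') by apply: homog_elem; apply: gdegZ.
have [| |||y [ys yh yd]] := IH (x - cdiff P (elem m v')) (ltnW hm).
- by move=> i u im; apply: hX; apply: ltnW.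
- apply: suppS; first by apply: suppB => //; apply: supp_cdiff.
  rewrite !fctE cdiff_top // /elem eqxx /v' dgm_dZ scalerA -expr2 sqrr_sign.
  by rewrite scale1r -ev subrr.
- by apply: homogB => //; rewrite -[t](subrK 1); apply: homog_cdiff.
- by rewrite cdiffB hd cdiffK subrr.
exists (y + elem m v'); split.
- by apply: suppD => //; apply: supp_le ys.
- exact: homogD.
- by rewrite cdiffD yd subrK.
Qed.

End Chains.

Lemma cdiff_map P (X Y : dgmod R) (f : X -> Y) (x : nat -> X) : is_dgmap f ->
  cdiff P (f \o x) = f \o cdiff P x.
Proof.
move=> hf; apply/funext => i; rewrite /cdiff /= (dgmapD hf) (dgmapZ hf) (dgmap_d hf).
by rewrite (dgmap_sum hf); congr (_ + _); apply: eq_bigr => l _; rewrite (dgmap_act hf).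
Qed.

Lemma supp_map m (X Y : dgmod R) (f : X -> Y) (x : nat -> X) : is_dgmap f ->
  supp m x -> supp m (f \o x).
Proof. by move=> hf h i hi; rewrite /= h // (dgmap0 hf). Qed.

Lemma homog_map P t (X Y : dgmod R) (f : X -> Y) (x : nat -> X) : is_dgmap f ->
  homog P t x -> homog P t (f \o x).
Proof. by move=> hf h i; apply: (dgmap_deg hf); apply: h. Qed.

Lemma comp_mapB (X Y : dgmod R) (f : X -> Y) (x y : nat -> X) : is_dgmap f ->
  f \o (x - y) = (f \o x) - (f \o y).
Proof. by move=> hf; apply/funext => i; rewrite /= !fctE (dgmapB hf). Qed.

Lemma comp_mapD (X Y : dgmod R) (f : X -> Y) (x y : nat -> X) : is_dgmap f ->
  f \o (x + y) = (f \o x) + (f \o y).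
Proof. by move=> hf; apply/funext => i; rewrite /= !fctE (dgmapD hf). Qed.

Section Extension.
Variables (P Q : cells) (X : dgmod R).
Hypotheses (triQ : cells_tri Q) (PQ : extends P Q).
Implicit Type x : nat -> X.

Lemma homog_ext t x : supp (csz P) x -> homog P t x <-> homog Q t x.
Proof.
move=> hx; split=> h i; have := h i; have [iP|Pi] := ltnP i (csz P).
- by have [-> _] := PQ.2 i iP.
- by rewrite hx // => _; apply: gdeg0.
- by have [-> _] := PQ.2 i iP.
- by rewrite hx // => _; apply: gdeg0.
Qed.

Lemma cdiff_ext x : cells_tri P -> supp (csz P) x -> cdiff Q x = cdiff P x.
Proof.
move=> triP hx; apply/funext => i.
have [iP|Pi] := ltnP i (csz P); last first.
  rewrite (supp_cdiff triP (leqnn _) hx Pi).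
  by rewrite (supp_cdiff triQ PQ.1 hx).
rewrite /cdiff; have [-> _] := PQ.2 i iP; congr (_ + _).
rewrite (big_ord_widen_cond _ xpredT (fun l => dgm_act X (ccol P l i) (x l)) PQ.1).
rewrite [LHS](bigID (fun l : 'I__ => (l < csz P)%N)) /= [X in _ + X]big1 ?addr0.
  by apply: eq_bigr => l lP; have [_ ->] := PQ.2 l lP.
by move=> l; rewrite -leqNgt => /hx ->; rewrite linear0.
Qed.

End Extension.

(* The mapping cone of [f] is acyclic: degreewise form of [quasi_iso]. *)
Lemma quasi_iso_cone (X Y : dgmod R) (f : X -> Y) n x y : quasi_iso f ->
  gdeg (dgm_gr X) (n + 1) x -> gdeg (dgm_gr Y) n y ->
  dgm_d X x = 0 -> f x = dgm_d Y y ->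
  exists u v, [/\ gdeg (dgm_gr X) n u, gdeg (dgm_gr Y) (n - 1) v,
    x = dgm_d X u & y = f u + dgm_d Y v].
Proof.
move=> [hf surj inj] hx hy dx fx.
have fdeg m z : gdeg (dgm_gr X) m z -> gdeg (dgm_gr Y) (m + 0) (f z).
  by rewrite addr0; apply: dgmap_deg.
have ddeg (Z : dgmod R) m z : gdeg (dgm_gr Z) m z -> gdeg (dgm_gr Z) (m + 1) (dgm_d Z z).
  exact: dgm_d_deg.
(* Injectivity on cohomology makes x a boundary; surjectivity is then applied to the cocycle y - f
   w1. *)
have [w ew] : exists w, x = dgm_d X w by apply: inj => //; exists y.
have [w1 hw1 ew1] : exists2 w1, gdeg (dgm_gr X) n w1 & x = dgm_d X w1.
  have [w1] := homog_preimage (dgm_d_lin (d := X)) (@ddeg X) hx (esym ew).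
  by rewrite addrK => h1 h2; exists w1.
have dy : dgm_d Y (y - f w1) = 0.
  by rewrite linearB /= -(dgmap_d hf) -ew1 fx subrr.
have [x1 [z [dx1 ez]]] := surj _ dy.
have hb : gdeg (dgm_gr Y) n (y - f w1).
  by apply: gdegB => //; apply: dgmap_deg.
have [hl _ _ _] := hf.
have [] := homog_solution (x := x1) (y := - z) hl fdeg
  (dgm_d_lin (d := Y)) (@ddeg Y) hb.
  by rewrite linearN ez addrK.
move=> c1 [c2 [C1 [h2 _] e]]; rewrite subr0 in e.
exists (w1 + c1 n), (c2 (n - 1)); split => //.
- by apply: gdegD => //; case: C1.
(* The components of the cocycle x1 are again cocycles, so adding one to w1 does not change the
   boundary. *)
- have C := components_map (dgm_d_lin (d := X)) (@ddeg X) C1.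
  rewrite dx1 in C.
  have := components_uniq C (components_homog (gdeg0 _ 0)) (n + 1).
  by rewrite addrK if_same linearD /= -ew1 => ->; rewrite addr0.
- by rewrite (dgmapD hf) -addrA e addrC subrK.
Qed.

(** Tensoring with P preserves acyclicity of the mapping cone, by the same induction as in
    [cdiff_exact]. With x = 0 this yields surjectivity on cohomology, in general injectivity. *)
Lemma cdiff_cone P (X Y : dgmod R) (f : X -> Y) m t x y : cells_ok P ->
  quasi_iso f -> (m <= csz P)%N ->
  supp m x -> supp m y -> homog P (t + 1) x -> homog P t y ->
  cdiff P x = 0 -> (f \o x) = cdiff P y ->
  exists u v, [/\ supp m u, supp m v, homog P t u, homog P (t - 1) v &
    x = cdiff P u /\ y = (f \o u) + cdiff P v].
Proof.
move=> okP qf; have hf : is_dgmap f by case: qf.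
have triP := ok_tri okP; elim: m x y => [|m IH] x y hm xs ys xh yh dx fx.
  exists 0, 0; split; [exact: supp0|exact: supp0|exact: homog0|exact: homog0|].
  rewrite !cdiff0 addr0; split; apply/funext => i; first by rewrite xs.
  by rewrite ys //= (dgmap0 hf).
pose s := (-1 : K) ^+ cdeg P m.
have ss (V : lmodType K) (z : V) : s *: (s *: z) = z.
  by rewrite scalerA -expr2 sqrr_sign scale1r.
have dxm : dgm_d X (x m) = 0.
  have := congr1 (fun g => g m) dx; rewrite cdiff_top //= => /eqP.
  by rewrite scaler_eq0 signr_eq0 /= => /eqP.
have fxm : f (x m) = dgm_d Y (s *: y m).
  by have := congr1 (fun g => g m) fx; rewrite cdiff_top //= dgm_dZ.
have xh' : gdeg (dgm_gr X) (t - (cdeg P m)%:Z + 1) (x m).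
  by have := xh m; rewrite addrAC.
have [u [v [hu hv eu ev]]] :=
  quasi_iso_cone qf xh' (gdegZ s (yh m)) dxm fxm.
pose u' := elem m (s *: u); pose v' := elem m v.
have us : supp m.+1 u' by apply: supp_elem.
have vs : supp m.+1 v' by apply: supp_elem.
have uh : homog P t u' by apply: homog_elem; apply: gdegZ.
have vh : homog P (t - 1) v' by apply: homog_elem; rewrite addrAC.
have vh' : homog P t (cdiff P v') by rewrite -[t](subrK 1); apply: homog_cdiff.
have [||||||u1 [v1 [us1 vs1 uh1 vh1 [e1 e2]]]] :=
  IH (x - cdiff P u') (y - (f \o u') - cdiff P v') (ltnW hm).
- apply: suppS; first by apply: suppB => //; apply: supp_cdiff.
  by rewrite !fctE cdiff_top // /u' /elem eqxx dgm_dZ ss -eu subrr.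
- apply: suppS.
    by do !apply: suppB => //; [apply: supp_map | apply: supp_cdiff].
  rewrite !fctE cdiff_top // /u' /v' /elem /= eqxx (dgmapZ hf).
  by rewrite -/s -[y m]ss ev -addrA -opprD -scalerDr subrr.
- by apply: homogB => //; apply: homog_cdiff.
- by do !apply: homogB => //; apply: homog_map.
- by rewrite cdiffB dx cdiffK // subrr.
- by rewrite (comp_mapB _ _ hf) fx !cdiffB cdiffK // subr0 (cdiff_map _ _ hf).
exists (u1 + u'), (v1 + v'); split.
- by apply: suppD => //; apply: supp_le us1.
- by apply: suppD => //; apply: supp_le vs1.
- exact: homogD.
- exact: homogD.
rewrite !cdiffD -e1 subrK (comp_mapD _ _ hf); split => //.
by rewrite addrACA -e2 -(addrA y) -opprD subrK.
Qed.


(** * Bounded Tor *)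

Definition cocycle P (X : dgmod R) t (x : nat -> X) :=
  [/\ supp (csz P) x, homog P t x & cdiff P x = 0].

Definition boundary P (X : dgmod R) t (x : nat -> X) :=
  exists y, [/\ supp (csz P) y, homog P (t - 1) y & cdiff P y = x].

(* P is a stage of a minimal semifree resolution of the right module k,
   correct in degrees strictly between 0 and n. *)
Record stage (n : nat) (P : cells) : Prop := Stage {
  stage_ok : cells_ok P;
  stage_gt0 : (0 < csz P)%N;
  stage_deg : forall l, (l < csz P)%N -> (cdeg P l < n)%N;
  stage_exact : forall t x, 0 < t -> t < n%:Z ->
    cocycle P (X := regmod R) t x -> boundary P t x }.

(* The Tor-groups colim H^t(P (x)_R X), over the stages P, vanish for t > N;
   vanishing of the colimit is expressed by ind-triviality. *)
Definition tor_bounded (X : dgmod R) := exists N : int,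
  forall n P, stage n P -> exists n' Q, [/\ stage n' Q, extends P Q &
    forall t x, N < t -> cocycle P (X := X) t x -> boundary Q t x].

Lemma cocycle_ext P Q (X : dgmod R) t (x : nat -> X) :
  cells_ok P -> cells_ok Q -> extends P Q -> cocycle P t x -> cocycle Q t x.
Proof.
move=> okP okQ PQ [xs xh dx]; split.
- exact: supp_le PQ.1 xs.
- exact/(homog_ext PQ).
- by rewrite (cdiff_ext (ok_tri okQ) PQ (ok_tri okP)).
Qed.

Lemma boundary_ext P Q (X : dgmod R) t (x : nat -> X) :
  cells_ok P -> cells_ok Q -> extends P Q -> boundary P t x -> boundary Q t x.
Proof.
move=> okP okQ PQ [y [ys yh dy]]; exists y; split.
- exact: supp_le PQ.1 ys.
- exact/(homog_ext PQ).
- by rewrite (cdiff_ext (ok_tri okQ) PQ (ok_tri okP)).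
Qed.

Lemma boundary_lin P (X : dgmod R) t (a : K) (x y : nat -> X) :
  boundary P t x -> boundary P t y -> boundary P t (a *: x + y).
Proof.
move=> [u [us uh <-]] [v [vs vh <-]]; exists (a *: u + v); split.
- by move=> i hi; rewrite !fctE us // vs // scaler0 addr0.
- by move=> i; apply: gdeg_lin.
- by rewrite cdiffD cdiffZ.
Qed.

Lemma boundary0 P (X : dgmod R) t : boundary P t (0 : nat -> X).
Proof.
exists 0; split; [exact: supp0 | exact: homog0 | exact: cdiff0].
Qed.

(** Preimages are chosen coordinatewise, made homogeneous by [homog_preimage] and set to 0 from m
    on. *)
Lemma lift_chain P (X Y : dgmod R) (f : X -> Y) m t (y : nat -> Y) :
  is_dgmap f -> (forall i, exists u, f u = y i) -> supp m y -> homog P t y ->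
  exists x, [/\ supp m x, homog P t x & f \o x = y].
Proof.
move=> hf hy ys yh.
have hl : forall a x x', f (a *: x + x') = a *: f x + f x' by case: hf.
have hd n x : gdeg (dgm_gr X) n x -> gdeg (dgm_gr Y) (n + 0) (f x).
  by rewrite addr0; apply: dgmap_deg.
have /choice[x hx] : forall i, exists u, [/\ (m <= i)%N -> u = 0,
    gdeg (dgm_gr X) (t - (cdeg P i)%:Z) u & f u = y i].
  move=> i; have [mi|im] := leqP m i.
    by exists 0; split; [|apply: gdeg0|rewrite ys // dgmap0].
  have [u eu] := hy i; have [u' h1 h2] := homog_preimage hl hd (yh i) eu.
  by exists u'; split => //; rewrite subr0 in h1.
exists x; split; first by move=> i /[dup] mi; have [/(_ mi)] := hx i.
  by move=> i; have [_] := hx i.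
by apply/funext => i /=; have [_ _] := hx i.
Qed.

Lemma comp_inj0 (X Y : dgmod R) (f : X -> Y) (x : nat -> X) : is_dgmap f ->
  injective f -> f \o x = 0 -> x = 0.
Proof.
move=> hf fI e; apply/funext => i; apply: fI.
by have := congr1 (fun g => g i) e; rewrite /= (dgmap0 hf).
Qed.

(** * Two out of three for bounded Tor *)

Section ShortExact.
Variables (X Y Z : dgmod R) (f : X -> Y) (g : Y -> Z).
Hypothesis fg : ses f g.
Let hf : is_dgmap f. Proof. by case: fg. Qed.
Let hg : is_dgmap g. Proof. by case: fg. Qed.
Let fI : injective f. Proof. by case: fg. Qed.

Lemma ses_lift P m t (z : nat -> Z) : supp m z -> homog P t z ->
  exists y, [/\ supp m y, homog P t y & g \o y = z].
Proof. by case: fg => _ _ _ h _; apply: lift_chain. Qed.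

Lemma ses_kernel P m t (y : nat -> Y) : supp m y -> homog P t y -> g \o y = 0 ->
  exists x, [/\ supp m x, homog P t x & f \o x = y].
Proof.
case: fg => _ _ _ _ h ys yh gy; apply: lift_chain => // i.
have /h[x ->] : g (y i) = 0 by have := congr1 (fun u => u i) gy.
by exists x.
Qed.

Lemma comp_ses (x : nat -> X) : g \o (f \o x) = 0.
Proof.
case: fg => _ _ _ _ h; apply/funext => i /=.
by apply/(h (f (x i))); exists (x i).
Qed.

Lemma cocycle_kernel P t (y : nat -> Y) : cocycle P t y -> g \o y = 0 ->
  exists2 x, cocycle P t x & f \o x = y.
Proof.
move=> [ys yh dy] gy; have [x [xs xh e]] := ses_kernel ys yh gy.
exists x => //; split => //; apply: (comp_inj0 hf fI).
by rewrite -(cdiff_map _ _ hf) e.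
Qed.

(** Exactness of H^t(Y) -> H^t(Z) -> H^(t+1)(X): a first extension of P kills the image in X, a
    second one kills the resulting class from Y. *)
Lemma tor_bounded_ses3 : tor_bounded X -> tor_bounded Y -> tor_bounded Z.
Proof.
move=> [N1 h1] [N2 h2]; exists (Num.max N1 N2) => n P sP.
have [n1 [P1 [sP1 PP1 k1]]] := h1 n P sP.
have [n2 [P2 [sP2 P12 k2]]] := h2 n1 P1 sP1.
have [okP okP1 okP2] := And3 (stage_ok sP) (stage_ok sP1) (stage_ok sP2).
exists n2, P2; split => //; first exact: extends_trans P12.
move=> t z; rewrite gt_max => /andP[tN1 tN2] [zs zh dz].
have [y [ys yh ey]] := ses_lift zs zh.
(* This x represents the image of z under the connecting map. *)
have [||x xc ex] := @cocycle_kernel P (t + 1) (cdiff P y).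
- split; [exact: supp_cdiff (ok_tri okP) (leqnn _) ys|exact: homog_cdiff|].
  exact: cdiffK.
- by rewrite -(cdiff_map _ _ hg) ey.
have [|x1 [x1s x1h dx1]] := k1 _ x _ xc; first by lia.
rewrite addrK in x1h.
have ysP1 : supp (csz P1) y by apply: supp_le PP1.1 ys.
have [||y2 [y2s y2h dy2]] := k2 t (y - (f \o x1)) => //.
  split.
  - by apply: suppB => //; apply: supp_map.
  - by apply: homogB; [apply/(homog_ext PP1)|apply: homog_map].
  - rewrite cdiffB (cdiff_map _ _ hf) dx1 ex.
    by rewrite (cdiff_ext (ok_tri okP1) PP1 (ok_tri okP)) // subrr.
exists (g \o y2); split; [exact: supp_map|exact: homog_map|].
by rewrite (cdiff_map _ _ hg) dy2 (comp_mapB _ _ hg) comp_ses subr0.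
Qed.

(** The same chase for H^t(X) -> H^t(Y) -> H^t(Z). *)
Lemma tor_bounded_ses2 : tor_bounded X -> tor_bounded Z -> tor_bounded Y.
Proof.
move=> [N1 h1] [N2 h2]; exists (Num.max N1 N2) => n P sP.
have [n1 [P1 [sP1 PP1 k1]]] := h2 n P sP.
have [n2 [P2 [sP2 P12 k2]]] := h1 n1 P1 sP1.
have [okP okP1 okP2] := And3 (stage_ok sP) (stage_ok sP1) (stage_ok sP2).
exists n2, P2; split => //; first exact: extends_trans P12.
move=> t y; rewrite gt_max => /andP[tN1 tN2] yc; have [ys yh dy] := yc.
have [||z1 [z1s z1h dz1]] := k1 t (g \o y) => //.
  split; [exact: supp_map|exact: homog_map|].
  by rewrite (cdiff_map _ _ hg) dy; apply/funext => i /=; rewrite (dgmap0 hg).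
have [y1 [y1s y1h ey1]] := ses_lift z1s z1h.
have [y1ysP1 y1yh dyP1] := cocycle_ext okP okP1 PP1 yc.
have [||x xc ex] := @cocycle_kernel P1 t (y - cdiff P1 y1).
- split.
  + by apply: suppB => //; apply: supp_cdiff => //; apply: ok_tri.
  + by apply: homogB => //; rewrite -[t](subrK 1); apply: homog_cdiff.
  + by rewrite cdiffB dyP1 cdiffK // subrr.
- by rewrite (comp_mapB _ _ hg) -(cdiff_map _ _ hg) ey1 dz1 subrr.
have [|x2 [x2s x2h dx2]] := k2 t x _ xc => //.
exists (y1 + (f \o x2)); split.
- by apply: suppD; [apply: supp_le P12.1 y1s|apply: supp_map].
- by apply: homogD; [apply/(homog_ext P12)|apply: homog_map].
rewrite cdiffD (cdiff_map _ _ hf) dx2 ex.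
by rewrite (cdiff_ext (ok_tri okP2) P12 (ok_tri okP1)) // addrC subrK.
Qed.

Lemma tor_bounded_ses1 : tor_bounded Y -> tor_bounded Z -> tor_bounded X.
Proof.
(* The chase uses H^(t-1)(Z) -> H^t(X) -> H^t(Y), so the bound for Z is needed one degree lower. *)
move=> [N1 h1] [N2 h2]; exists (Num.max N1 (N2 + 1)) => n P sP.
have [n1 [P1 [sP1 PP1 k1]]] := h1 n P sP.
have [n2 [P2 [sP2 P12 k2]]] := h2 n1 P1 sP1.
have [okP okP1 okP2] := And3 (stage_ok sP) (stage_ok sP1) (stage_ok sP2).
exists n2, P2; split => //; first exact: extends_trans P12.
move=> t x; rewrite gt_max => /andP[tN1 tN2] [xs xh dx].
have [||y1 [y1s y1h dy1]] := k1 t (f \o x) => //.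
  split; [exact: supp_map|exact: homog_map|].
  by rewrite (cdiff_map _ _ hf) dx; apply/funext => i /=; rewrite (dgmap0 hf).
have [||z2 [z2s z2h dz2]] := k2 (t - 1) (g \o y1); first by lia.
  split; [exact: supp_map|exact: homog_map|].
  by rewrite (cdiff_map _ _ hg) dy1 comp_ses.
have [y2 [y2s y2h ey2]] := ses_lift z2s z2h.
have [|||x' [x's x'h ex']] := @ses_kernel P2 (csz P2) (t - 1) (y1 - cdiff P2 y2).
- apply: suppB; first exact: supp_le P12.1 y1s.
  by apply: supp_cdiff => //; apply: ok_tri.
- apply: homogB; first exact/(homog_ext P12).
  by rewrite -[t - 1](subrK 1); apply: homog_cdiff.
- by rewrite (comp_mapB _ _ hg) -(cdiff_map _ _ hg) ey2 dz2 subrr.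
exists x'; split => //; apply/eqP; rewrite -subr_eq0; apply/eqP.
apply: (comp_inj0 hf fI); rewrite (comp_mapB _ _ hf) -(cdiff_map _ _ hf) ex'.
rewrite cdiffB cdiffK // subr0 (cdiff_ext (ok_tri okP2) P12 (ok_tri okP1)) //.
by rewrite dy1 subrr.
Qed.

End ShortExact.

Lemma cocycle_map P t (X Y : dgmod R) (f : X -> Y) (x : nat -> X) : is_dgmap f ->
  cocycle P t x -> cocycle P t (f \o x).
Proof.
move=> hf [xs xh dx]; split; [exact: supp_map|exact: homog_map|].
by rewrite (cdiff_map _ _ hf) dx; apply/funext => i /=; rewrite (dgmap0 hf).
Qed.

Lemma boundary_map P t (X Y : dgmod R) (f : X -> Y) (x : nat -> X) : is_dgmap f ->
  boundary P t x -> boundary P t (f \o x).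
Proof.
move=> hf [y [ys yh <-]]; exists (f \o y).
by split; [exact: supp_map|exact: homog_map|exact: cdiff_map].
Qed.

Lemma tor_bounded_retract (X Z : dgmod R) (i : X -> Z) (p : Z -> X) :
  is_dgmap i -> is_dgmap p -> (forall x, p (i x) = x) ->
  tor_bounded Z -> tor_bounded X.
Proof.
move=> hi hp pi [N h]; exists N => n P sP.
have [n' [Q [sQ PQ k]]] := h n P sP; exists n', Q; split => // t x tN xc.
have -> : x = p \o (i \o x) by apply/funext => j /=; rewrite pi.
by apply: boundary_map => //; apply: k => //; apply: cocycle_map.
Qed.

Lemma tor_bounded_qis (X Y : dgmod R) (f : X -> Y) : quasi_iso f ->
  tor_bounded X -> tor_bounded Y.
Proof.
move=> qf [N h]; exists N => n P sP; have hf : is_dgmap f by case: qf.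
have [n' [Q [sQ PQ k]]] := h n P sP; exists n', Q; split => // t y tN yc.
have [ys yh dy] := yc.
(* The cone is applied to the pair (0, y): up to a boundary, y is the image of a cocycle u. *)
have [||u [v [us vs uh vh [du ->]]]] :=
  cdiff_cone (x := 0) (stage_ok sP) qf (leqnn _) _ ys (homog0 P X _) yh (cdiff0 P X) _.
- exact: supp0.
- by rewrite dy; apply/funext => i /=; rewrite (dgmap0 hf).
rewrite -[f \o u]scale1r; apply: boundary_lin.
  by apply: boundary_map => //; apply: k.
apply: (boundary_ext (stage_ok sP) (stage_ok sQ) PQ).
by exists v.
Qed.

Lemma tor_bounded_qis_inv (X Y : dgmod R) (f : X -> Y) : quasi_iso f ->
  tor_bounded Y -> tor_bounded X.
Proof.
move=> qf [N h]; exists N => n P sP; have hf : is_dgmap f by case: qf.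
have [n' [Q [sQ PQ k]]] := h n P sP; exists n', Q; split => // t x tN xc.
have [y [ys yh dy]] := k t _ tN (cocycle_map hf xc).
have [xs xh dx] := cocycle_ext (stage_ok sP) (stage_ok sQ) PQ xc.
have xh' : homog Q (t - 1 + 1) x by rewrite subrK.
have [u [v [us _ uh _ [-> _]]]] :=
  cdiff_cone (stage_ok sQ) qf (leqnn _) xs ys xh' yh dx (esym dy).
by exists u.
Qed.

(** * Minimal resolutions of the residue field *)

Lemma dga_d1 : dga_d R 1 = 0.
Proof.
apply: dga_deg1; rewrite -[1]add0r; apply: dga_d_deg.
by apply/dga_deg0; exists 1; rewrite scale1r.
Qed.

(** By excluded middle, a subspace inside S is enlarged by missing vectors of S; k bounds its
    codimension and hence the number of steps. *)
Lemma vspace_of_submodule (V : vectType K) (S : V -> Prop) : S 0 ->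
  (forall (a : K) x y, S x -> S y -> S (a *: x + y)) ->
  exists U : {vspace V}, forall v, S v <-> v \in U.
Proof.
move=> S0 Slin.
suff main k (U : {vspace V}) : (\dim {:V} - \dim U < k)%N ->
    (forall v, v \in U -> S v) -> exists W : {vspace V}, forall v, S v <-> v \in W.
  apply: (main _ 0%VS (ltnSn _)) => v; rewrite memv0 => /eqP -> //.
elim: k U => // k IH U hk US.
have [|] := pselect (exists2 v, S v & v \notin U); last first.
  move=> nex; exists U => v; split => [Sv|/US //].
  by apply: contrapT => /negP vU; apply: nex; exists v.
move=> [v Sv vU]; apply: (IH (U + <[v]>)%VS); last first.
  move=> _ /memv_addP[u uU [_ /vlineP[a ->] ->]].
  by rewrite addrC; apply: Slin => //; apply: US.
have lt : (\dim U < \dim (U + <[v]>))%N.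
  rewrite ltn_neqAle dimvS ?addvSl // andbT; apply: contra vU => /eqP e.
  have : (U + <[v]> <= U)%VS by rewrite -(geq_leqif (dimv_leqif_sup (addvSl U <[v]>))) e.
  by rewrite subv_add => /andP[_]; rewrite -memvE.
by have := dimvS (subvf (U + <[v]>)%VS); lia.
Qed.

(** Chains on P form a finite-dimensional space, so finitely many cocycles span. Spanning is stated
    through linear predicates B, to be applied to boundaries in an extension of P. *)
Lemma cocycle_span P t : exists k (F : nat -> nat -> R),
  (forall i, (i < k)%N -> cocycle P (X := regmod R) t (F i)) /\
  forall B : (nat -> R) -> Prop, B 0 ->
    (forall (a : K) x y, B x -> B y -> B (a *: x + y)) ->
    (forall i, (i < k)%N -> B (F i)) ->
    forall x, cocycle P (X := regmod R) t x -> B x.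
Proof.
pose V := {ffun 'I_(csz P) -> R}.
pose ext (v : V) (i : nat) : R := if insub i is Some j then v j else 0.
have ext0 : ext 0 = 0.
  by apply/funext => i; rewrite /ext; case: insub => // j; rewrite ffunE.
have ext_lin a u v : ext (a *: u + v) = a *: ext u + ext v.
  apply/funext => i; rewrite !fctE /ext; case: insub => [j|]; last by rewrite scaler0 addr0.
  by rewrite !ffunE.
have [||U hU] := @vspace_of_submodule V (fun v => cocycle P (X := regmod R) t (ext v)).
- by rewrite ext0; split; [exact: supp0|exact: homog0|exact: cdiff0].
- move=> a u v [us uh du] [vs vh dv]; rewrite ext_lin; split.
  + by move=> i hi; rewrite !fctE us // vs // scaler0 addr0.
  + by move=> i; apply: gdeg_lin.
  + by rewrite cdiffD cdiffZ du dv scaler0 addr0.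
exists (\dim U), (fun i => ext (vbasis U)`_i); split.
  by move=> i iU; apply/hU; apply: vbasis_mem; apply: mem_nth; rewrite size_tuple.
move=> B B0 Blin BF x xc.
pose vx : V := [ffun j : 'I_(csz P) => x j].
have ex : x = ext vx.
  apply/funext => i; rewrite /ext; case: insubP => [j _ <-|]; first by rewrite ffunE.
  by rewrite -leqNgt; case: xc => xs _ _ /xs.
rewrite ex; have /coord_vbasis -> : vx \in U.
  by apply/hU; rewrite -ex.
apply: (big_ind (fun v => B (ext v))).
- by rewrite ext0.
- by move=> u v hu hv; rewrite -[u]scale1r ext_lin; apply: Blin.
- move=> i _; rewrite -[_ *: _]addr0 ext_lin ext0; apply: Blin => //.
  exact: BF.
Qed.

(** The new cell is last, has degree w and boundary c. *)
Definition attach P (w : nat) (c : nat -> R) : cells :=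
  Cells (csz P).+1 (fun l => if (l < csz P)%N then cdeg P l else w)
    (fun l => if (l < csz P)%N then ccol P l else c).

Lemma extends_attach P w c : extends P (attach P w c).
Proof. by split => //= l ->. Qed.

(** * Attaching a cell of degree n - 1 along a cocycle of degree n *)

Section Attach.
Variables (n : nat) (P : cells) (c : nat -> R).
Hypotheses (sP : stage n P) (cP : cocycle P (X := regmod R) n%:Z c).
Let Q := attach P n.-1 c.
Let PQ : extends P Q := extends_attach P n.-1 c.
Let okP := stage_ok sP.

Let n_gt0 : (0 < n)%N.
Proof. by have := stage_deg sP (stage_gt0 sP); apply: leq_trans. Qed.

Let triQ : cells_tri Q.
Proof.
move=> l i; rewrite /= ltnS => lP li; case: ifP => [lP'|/negbT].
  exact: (ok_tri okP).
by rewrite -leqNgt => Pl; case: cP => cs _ _; apply: cs; apply: leq_trans li.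
Qed.

Let col_supp l : (l < csz P)%N -> supp (X := regmod R) (csz P) (ccol P l).
Proof. by move=> lP i Pi; apply: (ok_tri okP) => //; apply: leq_trans (ltnW lP) Pi. Qed.

Lemma cells_ok_attach : cells_ok Q.
Proof.
have [cs ch dc] := cP; split => //.
- move=> i l il /=; rewrite ltnS => lP; case: ifP => iP; case: ifP => // lP'.
  + exact: (ok_mono okP).
  + by have := stage_deg sP iP; lia.
  + by move: iP; rewrite (leq_ltn_trans il lP').
- move=> l /=; rewrite ltnS => lP; case: ifP => lP'.
    by apply/(homog_ext PQ); [exact: col_supp|exact: (ok_deg okP)].
  by rewrite prednK //; apply/(homog_ext PQ).
- move=> l /=; rewrite ltnS => lP; case: ifP => lP'.
    rewrite (cdiff_ext triQ PQ (ok_tri okP)); last exact: col_supp.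
    exact: (ok_cycle okP).
  by rewrite (cdiff_ext triQ PQ (ok_tri okP)).
Qed.

Lemma cdiff_attach (r : R) : dga_d R r = 0 ->
  cdiff Q (X := regmod R) (elem (X := regmod R) (csz P) r) = fun i => c i * r.
Proof.
move=> dr; apply/funext => i; rewrite /cdiff big_ord_recr /= big1; last first.
  by move=> l _; rewrite /elem ltn_eqF // mulr0.
rewrite add0r ltnn /elem eqxx; case: eqP => _; last by rewrite dga_d0 scaler0 add0r.
by rewrite dr scaler0 add0r.
Qed.

Lemma boundary_attach : boundary Q (X := regmod R) n%:Z c.
Proof.
exists (elem (X := regmod R) (csz P) 1); split.
- by apply: supp_elem; rewrite ltnS.
- apply: homog_elem; rewrite /= ltnn.
  have -> : n%:Z - 1 - n.-1%:Z = 0 by lia.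
  by apply/dga_deg0; exists 1; rewrite scale1r.
- by rewrite cdiff_attach ?dga_d1 //; apply/funext => i; rewrite mulr1.
Qed.

(** No new cocycle appears below degree n: its coordinate on the new cell has degree at most 0,
    hence is a scalar a, and a != 0 would make c a boundary in P. *)
Lemma stage_attach : ~ boundary P (X := regmod R) n%:Z c -> stage n Q.
Proof.
move=> nbd; have okQ := cells_ok_attach; split => //.
  move=> l /=; rewrite ltnS => lP; case: ifP => [|_]; last by lia.
  exact: stage_deg.
move=> t x t0 tn xc; have [xs xh dx] := xc.
suff xP : supp (csz P) x.
  apply: (boundary_ext okP okQ PQ); apply: (stage_exact sP t0 tn); split => //.
    exact/(homog_ext PQ).
  by rewrite -(cdiff_ext triQ PQ (ok_tri okP)).
apply: suppS => //; have := xh (csz P); rewrite /= ltnn.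
have [tn1 xd|tn1] := ltP t (n%:Z - 1).
  by apply: dga_neg xd; lia.
have -> : t - n.-1%:Z = 0 by lia.
move=> /dga_deg0[a ea]; rewrite ea.
have [->|a0] := eqVneq a 0; first by rewrite scale0r.
case: nbd; pose x' := x - elem (X := regmod R) (csz P) (a%:A).
have x'P : supp (X := regmod R) (csz P) x'.
  apply: suppS; first by apply: suppB => //; apply: supp_elem; rewrite ltnS.
  by rewrite /x' !fctE /elem eqxx ea subrr.
have x'h : homog Q (X := regmod R) (n%:Z - 1) x'.
  have <- : t = n%:Z - 1 by lia.
  apply: homogB => //; apply: homog_elem; rewrite -ea; exact: xh.
have dx' : cdiff P (X := regmod R) x' = - (a *: c).
  rewrite -(cdiff_ext triQ PQ (ok_tri okP)) // cdiffB dx sub0r cdiff_attach.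
    by congr (- _); apply/funext => i; rewrite !fctE -scalerAr mulr1.
  by rewrite linearZ /= dga_d1 scaler0.
exists ((- a^-1) *: x'); split.
- by move=> i hi; rewrite !fctE x'P // scaler0.
- by move=> i; apply: gdegZ; have /(homog_ext PQ) := x'h; apply.
- by rewrite cdiffZ dx' scaleNr scalerN opprK scalerA mulVf // scale1r.
Qed.

End Attach.

(** Spanning cocycles are treated in turn, and a cell is attached only if the cocycle is not yet a
    boundary, as [stage_attach] demands. The degrees of the new cells are recorded for [stageS]. *)
Lemma stage_kill n P : stage n P -> exists Q, [/\ stage n Q, extends P Q,
  forall l, (csz P <= l)%N -> (l < csz Q)%N -> cdeg Q l = n.-1 &
  forall x, cocycle P (X := regmod R) n%:Z x -> boundary Q n%:Z x].
Proof.
move=> sP; have [k [F [Fc Fspan]]] := cocycle_span P n%:Z.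
suff [Q [sQ PQ cQ bQ]] : exists Q, [/\ stage n Q, extends P Q,
    forall l, (csz P <= l)%N -> (l < csz Q)%N -> cdeg Q l = n.-1 &
    forall i, (i < k)%N -> boundary Q (X := regmod R) n%:Z (F i)].
  exists Q; split => // x; apply: Fspan => //; first exact: boundary0.
  by move=> a u v; apply: boundary_lin.
elim: k Fc {Fspan} => [|k IH] Fc.
  exists P; split => // l h1 h2.
  by have := leq_trans h2 h1; rewrite ltnn.
have [|Q [sQ PQ cQ bQ]] := IH; first by move=> i ik; apply: Fc; apply: ltnW.
have [bk|nbk] := pselect (boundary Q (X := regmod R) n%:Z (F k)).
  by exists Q; split => // i; rewrite ltnS leq_eqVlt => /orP[/eqP ->|/bQ].
have Fk := cocycle_ext (stage_ok sP) (stage_ok sQ) PQ (Fc k (ltnSn k)).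
have QQ' := extends_attach Q n.-1 (F k).
exists (attach Q n.-1 (F k)); split.
- exact: stage_attach.
- exact: extends_trans QQ'.
- move=> l Pl /= _; case: ifP => // lQ; exact: cQ.
move=> i; rewrite ltnS leq_eqVlt => /orP[/eqP ->|/bQ]; first exact: boundary_attach.
by apply: boundary_ext QQ'; [exact: stage_ok sQ|exact: cells_ok_attach].
Qed.

Lemma stageS n P : stage n P -> exists2 Q, stage n.+1 Q & extends P Q.
Proof.
move=> sP; have [Q [sQ PQ cQ bQ]] := stage_kill sP.
have [okP okQ] := (stage_ok sP, stage_ok sQ).
have n_gt0 : (0 < n)%N by have := stage_deg sP (stage_gt0 sP); apply: leq_trans.
exists Q => //; split => //; first exact: stage_gt0 sQ.
  by move=> l lQ; apply: leqW; apply: stage_deg sQ _ lQ.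
move=> t x t0 tn xc; have [xs xh dx] := xc.
have [tn'|nt] := ltP t n%:Z; first exact: (stage_exact sQ t0 tn').
have {tn}et : t = n%:Z by lia.
(* On the new cells a cocycle of degree n has coordinates in R^1 = 0, so it lives on P and has
   already been killed. *)
have xP : supp (csz P) x.
  move=> i Pi; have [iQ|/xs //] := ltnP i (csz Q).
  apply: dga_deg1; have := xh i; rewrite (cQ i Pi iQ) et.
  by have -> : n%:Z - n.-1%:Z = 1 by lia.
subst t; apply: bQ; split => //; first exact/(homog_ext PQ).
by rewrite -(cdiff_ext (ok_tri okQ) PQ (ok_tri okP)).
Qed.

Lemma stage_extend n P k : stage n P -> exists2 Q, stage (n + k) Q & extends P Q.
Proof.
move=> sP; elim: k => [|k [Q sQ PQ]].
  by exists P; [rewrite addn0|exact: extends_refl].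
have [Q' sQ' QQ'] := stageS sQ; exists Q'; first by rewrite addnS.
exact: extends_trans QQ'.
Qed.

(** The resolution starts with R itself; the range 0 < t < 1 is empty. *)
Lemma stage1 : stage 1 (Cells 1 (fun _ => 0%N) (fun _ _ => 0)).
Proof.
split => //; last by move=> t x t0 t1; lia.
split => // l _; first exact: homog0.
exact: (cdiff0 _ (regmod R)).
Qed.

(** A bound for the components of finitely many basis vectors passes to their linear
    combinations. *)
Lemma dga_bounded : exists D : nat, forall i r, D%:Z < i ->
  gdeg (dga_gr R) i r -> r = 0.
Proof.
pose small D (v : R) := forall c, components (dga_gr R) v c ->
  forall i, D%:Z < i -> c i = 0.
have small_lin D a u v : small D u -> small D v -> small D (a *: u + v).
  move=> hu hv c hc i iD.
  have [cu Cu] := components_ex (dga_gr R) u.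
  have [cv Cv] := components_ex (dga_gr R) v.
  rewrite (components_uniq hc (components_lin a Cu Cv)).
  by rewrite (hu _ Cu) // (hv _ Cv) // scaler0 addr0.
have small0 D : small D 0.
  move=> c hc i _; rewrite (components_uniq hc (components_homog (gdeg0 _ i))).
  by rewrite if_same.
have [D hD] : exists D, forall v, v \in (vbasis {:R} : seq R) -> small D v.
  elim: (vbasis {:R} : seq R) => [|u s [D hD]]; first by exists 0%N.
  have [c Cu] := components_ex (dga_gr R) u; have [_ [sc [_ c0 _]]] := Cu.
  pose M := (\max_(i <- sc) `|i|)%N.
  have hM i : i \in sc -> (`|i| <= M)%N.
    by move=> isc; rewrite /M (big_rem i) //= leq_maxl.
  exists (maxn D M) => v; rewrite inE => /orP[/eqP ->|/hD hv].
    move=> c' Cu' i hi; rewrite (components_uniq Cu' Cu) c0 //.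
    by apply/negP => /hM; lia.
  by move=> c' Cv i hi; apply: (hv c') => //; lia.
exists D => i r iD hr; have sr : small D r.
  rewrite (coord_vbasis (memvf r)); apply: (big_ind (small D)) => //.
    by move=> u v hu hv; rewrite -[u]scale1r; apply: small_lin.
  move=> j _; rewrite -[_ *: _]addr0; apply: small_lin => //.
  by apply: hD; apply: mem_nth; rewrite size_tuple.
by have := sr _ (components_homog hr) i iD; rewrite eqxx.
Qed.

Lemma tor_bounded_regmod : tor_bounded (regmod R).
Proof.
have [D hD] := dga_bounded; exists 0 => n P sP.
have [Q sQ PQ] := stage_extend D sP; exists (n + D)%N, Q; split => // t x t0 xc.
have xcQ := cocycle_ext (stage_ok sP) (stage_ok sQ) PQ xc.
have [tn|nt] := ltP t (n + D)%N%:Z; first exact: (stage_exact sQ t0 tn).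
(* Cells of P have degree below n, so for t >= n + D every coordinate of x lies in degree above
   D. *)
suff -> : x = 0 by apply: boundary0.
case: xc => xs xh _; apply/funext => i; have [iP|/xs //] := ltnP i (csz P).
by apply: hD (xh i); have := stage_deg sP iP; lia.
Qed.

Lemma compact_tor_bounded (X : dgmod R) : compact X -> tor_bounded X.
Proof.
elim=> [|A B f qf _|A B f qf _|A B C f g fg _ + _|A B C f g fg _ + _
  |A B C f g fg _ + _|A B i p hi hp pi _].
- exact: tor_bounded_regmod.
- exact: tor_bounded_qis qf.
- exact: tor_bounded_qis_inv qf.
- exact: tor_bounded_ses3 fg.
- exact: tor_bounded_ses2 fg.
- exact: tor_bounded_ses1 fg.
- exact: tor_bounded_retract hi hp pi.
Qed.

(* The coefficients of P have positive degree, so they act as 0 on k. *)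
Lemma cdiff_kmod n P (x : nat -> kmod R) : stage n P -> cdiff P x = 0.
Proof.
move=> sP; have okP := stage_ok sP; apply/funext => i; rewrite /cdiff /= /kd scaler0 add0r.
rewrite big1 // => l _; have [li|il] := leqP l i.
  by rewrite (ok_tri okP) //; exact: (dgm_act0l (X := kmod R)).
rewrite /kact (dga_aug_deg _ (ok_deg okP (ltn_ord l) i)) ?mul0r //.
by have := ok_mono okP (ltnW il) (ltn_ord l); lia.
Qed.

(** Since the differential of P (x) k vanishes at every stage, each cell gives a class that no
    extension can kill, in the degree of the cell. *)
Lemma compact_kmod_cdeg : compact (kmod R) -> exists N : nat,
  forall n P l, stage n P -> (l < csz P)%N -> (cdeg P l <= N)%N.
Proof.
move=> /compact_tor_bounded[N h]; exists `|N|%N => n P l sP lP.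
rewrite leqNgt; apply/negP => Nl; have [n' [Q [sQ PQ k]]] := h n P sP.
have [||y [_ _]] := k (cdeg P l)%:Z (elem (X := kmod R) l 1); first by lia.
  split; [exact: supp_elem| |exact: cdiff_kmod sP].
  by apply: homog_elem; rewrite subrr.
rewrite (cdiff_kmod _ sQ) => /(congr1 (fun u => u l)); rewrite /elem eqxx.
by move/esym/eqP; rewrite oner_eq0.
Qed.

(** * The top cohomology class *)

(** Maximality of d is supplied separately, by [dimHR_top_class]. *)
Definition top_class (d : nat) (z : R) :=
  [/\ gdeg (dga_gr R) d%:Z z, dga_d R z = 0 & forall y, dga_d R y <> z].

(** Otherwise every component of a cocycle is a scalar or a boundary, so the kernel of d lies in K 1
    + im d and HR has dimension at most 1. *)
Lemma dimHR_class : (2 <= dimHR R)%N -> exists d z, (0 < d)%N /\ top_class d z.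
Proof.
rewrite /dimHR => dim2; apply: contrapT => none.
set D := linfun _ in dim2.
have DE v : D v = dga_d R v by rewrite /D lfunE.
have sub : (lker D <= <[1]> + limg D)%VS.
  apply/subvP => v; rewrite memv_ker DE => /eqP dv.
  have [c Cv] := components_ex (dga_gr R) v; have [hc [s [_ _ ->]]] := Cv.
  apply: memv_suml => i _.
  have dc : dga_d R (c i) = 0.
    have := components_map (@dga_d_lin K R) (@dga_d_deg K R) Cv; rewrite dv => C.
    have := components_uniq C (components_homog (gdeg0 _ 0)) (i + 1).
    by rewrite addrK if_same.
  have [i0|i0|ei] := ltgtP i 0.
  - by rewrite (dga_neg i0 (hc i)) mem0v.
  - have [[y ey]|ny] := pselect (exists y, dga_d R y = c i).
      apply: (subvP (addvSr _ _)); rewrite -ey -DE; apply: memv_img; exact: memvf.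
    case: none; exists `|i|%N, (c i); split; first by lia.
    split => //; first by rewrite gtz0_abs.
    by move=> y ey; apply: ny; exists y.
  - have /dga_deg0[a ->] : gdeg (dga_gr R) 0 (c i) by rewrite -ei.
    by apply: (subvP (addvSl _ _)); apply: memvZ; apply: memv_line.
have dim1 : (\dim <[1 : R]> <= 1)%N by rewrite dim_vline; case: (_ != _).
have := leq_trans (dimvS sub) (leq_trans (dimv_add_leqif <[1 : R]> (limg D)).1
  (leq_add dim1 (leqnn _))).
by move: dim2; rewrite ltn_subRL addnC => h; rewrite leqNgt h.
Qed.

(** The degrees carrying a nonzero class are bounded by [dga_bounded], so a largest one exists, and
    above it all homogeneous cocycles are boundaries. *)
Lemma dimHR_top_class : (2 <= dimHR R)%N -> exists d z,
  [/\ (0 < d)%N, top_class d z & forall i r, d%:Z < i ->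
    gdeg (dga_gr R) i r -> dga_d R r = 0 ->
    exists2 s, gdeg (dga_gr R) (i - 1) s & r = dga_d R s].
Proof.
move=> /dimHR_class[d0 [z0 [d0_gt0 hz0]]]; have [D hD] := dga_bounded.
pose p := [pred d | `[< exists z, top_class d z >]].
have exp : exists d, p d by exists d0; apply/asboolP; exists z0.
have ubp d : p d -> (d <= D)%N.
  move=> /asboolP[z [hz _ nz]]; rewrite leqNgt; apply/negP => Dd.
  apply: (nz 0); rewrite dga_d0; apply/esym; apply: hD hz; lia.
case: (ex_maxnP exp ubp) => d /asboolP[z hz] dmax.
have d0d : (d0 <= d)%N by apply: dmax; apply/asboolP; exists z0.
exists d, z; split => //; first by apply: leq_trans d0d.
move=> i r di hr dr.
have [y ey] : exists y, dga_d R y = r.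
  apply: contrapT => ny; suff : (`|i| <= d)%N by lia.
  apply: dmax; apply/asboolP; exists r; split => //.
    by rewrite gtz0_abs //; lia.
  by move=> y ey; apply: ny; exists y.
have [s hs es] := homog_preimage (@dga_d_lin K R) (@dga_d_deg K R) hr ey.
by exists s.
Qed.

End Linear.

(** * The contradiction on the last cell *)

Theorem mainTheorem5 (K : fieldType) (R : dga K) :
  (2 <= dimHR R)%N -> ~ compact (kmod R).
Proof.
move=> /dimHR_top_class[d [z [d_gt0 [hz dz nz] dexact]]] /compact_kmod_cdeg[N hN].
(* The stage is exact in degrees 1 to N + d, which include w + d because w <= N. *)
have [P sP _] := stage_extend (N + d) (stage1 R).
have okP := stage_ok sP; have := stage_gt0 sP.
case eP : (csz P) => [//|q] _; have qP : (q < csz P)%N by rewrite eP.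
have qN := hN _ _ _ sP qP; set w := cdeg P q in qN.
pose e := elem (X := regmod R) q z.
have es : supp (X := regmod R) q.+1 e by apply: supp_elem.
have eh : homog P (X := regmod R) (w + d)%N%:Z e.
  by apply: homog_elem; rewrite -/w; have -> : (w + d)%N%:Z - w%:Z = d%:Z by lia.
(* As dz = 0, the boundary of e lives on the cells before q. Their degrees are at most w, so its
   coordinates have degree at least d + 1, where HR vanishes. *)
have [|||||c [cs ch dc]] := @cdiff_exact K R P (regmod R) okP q
  ((w + d)%N%:Z + 1) (cdiff P e).
- exact: ltnW.
- move=> i u iq hu du.
  have iw : (cdeg P i <= w)%N := ok_mono okP (ltnW iq) qP.
  have [|s hs es'] := dexact _ u _ hu du; first by lia.
  by exists s => //; rewrite addrAC.
- apply: suppS; first exact: (supp_cdiff (ok_tri okP)).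
  by rewrite cdiff_top // /e /elem eqxx /= dz scaler0.
- exact: homog_cdiff.
- exact: cdiffK.
rewrite addrK in ch.
have [|||y [ys yh dy]] := stage_exact (x := e - c) sP (t := (w + d)%N%:Z).
- by lia.
- by lia.
- split; [|exact: homogB|by rewrite cdiffB dc subrr].
  by rewrite eP; apply: suppB => //; apply: supp_le cs.
(* The correction c vanishes on the last cell, so the coordinate there exhibits z as a boundary. *)
rewrite eP in ys; have := congr1 (fun u => u q) dy.
rewrite cdiff_top // !fctE /e /elem eqxx cs // subr0 -dgm_dZ.
exact: nz.
Qed.
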